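(* For every entrywise nonnegative matrix $A\in\mathbb R_+^{m\times n}$ we have $\operatorname{rank}_+(A)\ge\tau_+(A)$.
   Context: $\mathbb R_+^{m\times n}$ is the set of entrywise nonnegative real $m\times n$ matrices, and $\le$ between matrices is entrywise. The nonnegative rank $\operatorname{rank}_+(A)$ is the smallest integer $r$ such that $A=\sum_{i=1}^r u_iv_i^T$ with entrywise nonnegative vectors $u_i\in\mathbb R^m$, $v_i\in\mathbb R^n$. Define $$\mathcal A_+(A)=\{R\in\mathbb R^{m\times n}: \operatorname{rank}R\le 1,\ 0\le R\le A\},$$ $$\tau_+(A)=\max\{L(A): L \text{ a linear functional on }\mathbb R^{m\times n},\ L(R)\le 1\ \ \forall R\in\mathcal A_+(A)\}.$$ *)

(* Defs.v *)
From HB Require Import structures.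
From mathcomp Require Import all_boot all_order all_algebra.
From mathcomp Require Import all_classical all_reals all_analysis.
Set Implicit Arguments.
Unset Strict Implicit.
Unset Printing Implicit Defensive.
Import Order.TTheory GRing.Theory Num.Theory.
Import numFieldNormedType.Exports.
Local Open Scope classical_set_scope.
Local Open Scope ring_scope.

Definition nonneg_mx (R : realType) (m n : nat) (A : 'M[R]_(m, n)) : Prop :=
  forall i j, 0 <= A i j.

Definition nonneg_decomposition (R : realType) (m n : nat) (A : 'M[R]_(m, n))
    (r : nat) : Prop :=
  exists (u : 'I_r -> 'cV[R]_m) (v : 'I_r -> 'cV[R]_n),
    [/\ forall k, nonneg_mx (u k), forall k, nonneg_mx (v k) &
        A = \sum_(k < r) u k *m (v k)^T].

Lemma nonneg_decomposition_exists (R : realType) (m n : nat)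
    (A : 'M[R]_(m, n)) :
  nonneg_mx A -> exists r, `[< nonneg_decomposition A r >].
Proof.
move=> A0; exists m; apply/asboolP.
exists (fun k => delta_mx k 0), (fun k => (row k A)^T); split.
- by move=> k i j; rewrite mxE ler0n.
- by move=> k i j; rewrite !mxE.
- rewrite -[LHS]mul1mx mx1_sum_delta mulmx_suml; apply: eq_bigr => k _.
  by rewrite trmxK rowE mulmxA mul_delta_mx.
Qed.

(* [ex_minn] needs an inhabited predicate, hence the nonnegativity proof as an
   argument; the value does not depend on it. *)
Definition nonneg_rank (R : realType) (m n : nat) (A : 'M[R]_(m, n))
    (hA : nonneg_mx A) : nat :=
  ex_minn (nonneg_decomposition_exists hA).

Definition Aplus (R : realType) (m n : nat) (A : 'M[R]_(m, n)) :
    set 'M[R]_(m, n) :=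
  [set X | (\rank X <= 1)%N /\ forall i j, 0 <= X i j <= A i j].

Definition tau_feasible (R : realType) (m n : nat) (A : 'M[R]_(m, n))
    (L : {scalar 'M[R]_(m, n)}) : Prop :=
  forall X, Aplus A X -> L X <= 1.

(* The supremum is taken in the extended reals so that it has no junk value;
   for nonnegative [A] it is a maximum, see [tau_plus_max]. *)
Definition tau_plus (R : realType) (m n : nat) (A : 'M[R]_(m, n)) : \bar R :=
  ereal_sup [set (L A)%:E | L in @tau_feasible R m n A].

(* Only the values of a functional on the support of [A] matter on
   [Aplus A]; [y] records its values on the matrices [A i j *: delta_mx i j],
   and the convention [0^-1 = 0] discards the coordinates off the support. *)
Definition ell (R : realType) (m n : nat) (A : 'M[R]_(m, n))
    (y : 'rV[R]_(m * n)) (X : 'M[R]_(m, n)) : R :=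
  \sum_i \sum_j y 0 (mxvec_index i j) * (X i j / A i j).

Lemma ell_linear (R : realType) (m n : nat) (A : 'M[R]_(m, n)) y :
  linear_for *%R (ell A y).
Proof.
move=> a X Y; rewrite /ell mulr_sumr -big_split; apply: eq_bigr => i _ /=.
rewrite mulr_sumr -big_split; apply: eq_bigr => j _ /=.
by rewrite !mxE mulrDl mulrDr; congr (_ + _); rewrite -mulrA mulrCA.
Qed.

HB.instance Definition _ (R : realType) (m n : nat) (A : 'M[R]_(m, n)) y :=
  GRing.isLinear.Build R 'M[R]_(m, n) R *%R (ell A y) (ell_linear A y).

Lemma ell_continuous (R : realType) (m n : nat) (A : 'M[R]_(m, n)) X :
  continuous (fun y => ell A y X).
Proof.
have fin T (s : seq T) (f : T -> 'rV[R]_(m * n) -> R) :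
    (forall t, continuous (f t)) -> continuous (fun y => \sum_(t <- s) f t y).
  move=> cf; elim: s => [|t s IHs].
    rewrite (_ : (fun y => _) = fun=> 0); first exact: cst_continuous.
    by apply/funext => y; rewrite big_nil.
  rewrite (_ : (fun y => _) = f t \+ (fun y => \sum_(t <- s) f t y)).
    by move=> y; apply: continuousD; [exact: cf|exact: IHs].
  by apply/funext => y; rewrite big_cons.
apply: (fin) => i; apply: (fin) => j y.
apply: (@cvgMr_tmp _ _ (nbhs y)).
exact: (@coord_continuous R 1 (m * n) 0 (mxvec_index i j) y).
Qed.

Lemma Aplus_cell (R : realType) (m n : nat) (A : 'M[R]_(m, n)) i j :
  nonneg_mx A -> Aplus A (A i j *: delta_mx i j).
Proof.
move=> A0; split.
  have /mxrankS := scalemx_sub (A i j) (submx_refl (@delta_mx R m n i j)).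
  by rewrite mxrank_delta.
move=> a b; rewrite !mxE; case: eqP => [->|_] /=; last by rewrite mulr0 lexx A0.
by case: eqP => [->|_]; rewrite ?mulr1 ?mulr0 lexx A0.
Qed.

Lemma tau_attained (R : realType) (m n : nat) (A : 'M[R]_(m, n)) :
  nonneg_mx A -> exists L, tau_feasible A L /\
  forall L', tau_feasible A L' -> L' A <= L A.
Proof.
move=> A0; pose N : R := m%:R * n%:R.
have N0 : 0 <= N by rewrite mulr_ge0.
pose B : set 'rV[R]_(m * n) := [set y | forall k, `[- N, 1]%classic (y 0 k)].
pose K := B `&` [set y | forall X, Aplus A X -> ell A y X <= 1].
have cK : compact K.
  apply: compact_closedI.
    by apply: (@rV_compact _ _ (fun=> `[- N, 1]%classic)) => k;
      exact: segment_compact.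
  rewrite [X in closed X](_ : _ =
    \bigcap_(X in Aplus A) ((fun y => ell A y X) @^-1` [set x | x <= 1])).
    apply: closed_bigI => X _; apply: closed_comp; last exact: closed_le.
    by move=> y _; exact: ell_continuous.
  by apply/seteqP; split.
have ell0 X : ell A 0 X = 0.
  by rewrite /ell big1 // => i _; rewrite big1 // => j _; rewrite mxE mul0r.
have K0 : K 0.
  split=> [k|X _ /=]; last by rewrite ell0.
  by rewrite /= mxE in_itv /= oppr_le0 N0 ler01.
have [y /set_mem[_ Ky] ymax] := compact_EVT_max (ex_intro _ _ K0) cK
  (continuous_subspaceT (@ell_continuous _ _ _ A A)).
exists (ell A y : {scalar 'M[R]_(m, n)}); split; first exact: Ky.
move=> L HL; have [LA|LA] := leP (L A) 0.
  by rewrite (le_trans LA)// -(ell0 A) ymax// inE.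
pose Y : 'M[R]_(m, n) := \matrix_(i, j) L (A i j *: delta_mx i j).
have Lsum X : L X = \sum_i \sum_j X i j * L (delta_mx i j).
  rewrite {1}[X]matrix_sum_delta linear_sum; apply: eq_bigr => i _.
  by rewrite linear_sum; apply: eq_bigr => j _; rewrite linearZ.
have ellY X : Aplus A X -> ell A (mxvec Y) X = L X.
  move=> [_ HX]; rewrite Lsum /ell.
  apply: eq_bigr => i _; apply: eq_bigr => j _.
  rewrite mxvecE mxE linearZ /= mulrAC; congr (_ * _); rewrite mulrC.
  have [Aij|Aij] := eqVneq (A i j) 0; last by rewrite divfK.
  by move: (HX i j); rewrite Aij mulr0 => /le_anti.
have ellYA : ell A (mxvec Y) A = L A.
  rewrite Lsum /ell; apply: eq_bigr => i _; apply: eq_bigr => j _.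
  rewrite mxvecE mxE linearZ /= mulrAC; congr (_ * _); rewrite mulrC.
  by have [->|Aij] := eqVneq (A i j) 0; rewrite ?mulr0 ?divfK.
have Y1 i j : Y i j <= 1 by rewrite mxE; exact/HL/Aplus_cell.
have YN i j : - N <= Y i j.
  have YA : \sum_a \sum_b Y a b = L A.
    rewrite Lsum; apply: eq_bigr => a _; apply: eq_bigr => b _.
    by rewrite mxE linearZ.
  have : \sum_a \sum_b (1 - Y a b) <= N.
    rewrite (eq_bigr (fun a => n%:R - \sum_b Y a b)); last first.
      by move=> a _; rewrite sumrB sumr_const card_ord.
    rewrite sumrB sumr_const card_ord YA -[_ *+ m]mulr_natl -/N lerBlDr lerDl.
    exact: ltW.
  rewrite (bigD1 i)//= (bigD1 j)//= => H.
  have H1 : 0 <= \sum_(b | b != j) (1 - Y i b).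
    by apply: sumr_ge0 => b _; rewrite subr_ge0.
  have H2 : 0 <= \sum_(a | a != i) \sum_b (1 - Y a b).
    by apply: sumr_ge0 => a _; apply: sumr_ge0 => b _; rewrite subr_ge0.
  rewrite lerNl; apply: le_trans H; rewrite -!addrA addrCA lerDl.
  by rewrite !addr_ge0.
rewrite -ellYA; apply: ymax; rewrite inE; split=> [k|X AX /=]; last first.
  by rewrite ellY//; exact: HL.
by case/mxvec_indexP: k => i j; rewrite /= mxvecE in_itv /= YN Y1.
Qed.

Lemma tau_plus_max (R : realType) (m n : nat) (A : 'M[R]_(m, n)) :
  nonneg_mx A -> exists L, tau_feasible A L /\ tau_plus A = (L A)%:E.
Proof.
move=> A0; have [L [HL Lmax]] := tau_attained A0; exists L; split=> //.
apply/eqP; rewrite eq_le; apply/andP; split.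
  by apply: ge_ereal_sup => _ [L' HL' <-]; rewrite lee_fin Lmax.
by apply: ereal_sup_ubound; exists L.
Qed.

(* Main.v *)
Require Import Defs.
From mathcomp Require Import all_boot all_order all_algebra.
From mathcomp Require Import all_classical all_reals all_analysis.
Import Order.TTheory GRing.Theory Num.Theory.
Local Open Scope ring_scope.

(** If [A] is a sum of [r] nonnegative rank-one terms, each term lies below [A] because the others
    are nonnegative, so it belongs to [Aplus A]. A feasible [L] is then at most 1 on every term, and
    linearity gives [L A <= r]. It remains to take the supremum over [L] and a decomposition of
    minimal length. *)

Lemma nonneg_decomposition_Aplus (R : realType) (m n r : nat)
    (A : 'M[R]_(m, n)) (u : 'I_r -> 'cV[R]_m) (v : 'I_r -> 'cV[R]_n) :
  (forall k, nonneg_mx (u k)) -> (forall k, nonneg_mx (v k)) ->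
  A = \sum_(k < r) u k *m (v k)^T ->
  forall k, Aplus A (u k *m (v k)^T).
Proof.
move=> u0 v0 eA k; split.
  (* The product has rank at most that of [u k], a single column. *)
  by rewrite (leq_trans (mxrankM_maxl _ _))// rank_leq_col.
have uv0 l i j : 0 <= (u l *m (v l)^T) i j.
  by rewrite mxE sumr_ge0// => a _; rewrite mxE mulr_ge0// ?u0 ?v0.
(* Entrywise, [A] minus the [k]-th term is the sum of the other, nonnegative terms. *)
move=> i j; rewrite uv0 /= eA summxE (bigD1 k)//= lerDl.
by rewrite sumr_ge0.
Qed.

Lemma tau_plus_le_nonneg_decomposition (R : realType) (m n r : nat)
    (A : 'M[R]_(m, n)) :
  nonneg_decomposition A r -> (tau_plus A <= r%:R%:E)%E.
Proof.
move=> [u [v [u0 v0 eA]]]; apply: ge_ereal_sup => _ [L HL <-].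
rewrite lee_fin {1}eA linear_sum.
apply: (@le_trans _ _ (\sum_(k < r) 1)); last by rewrite sumr_const card_ord.
by apply: ler_sum => k _; exact/HL/nonneg_decomposition_Aplus.
Qed.

Theorem theorem2 (R : realType) (m n : nat) (A : 'M[R]_(m, n))
    (hA : nonneg_mx A) :
  ((nonneg_rank hA)%:R%:E >= tau_plus A)%E.
Proof.
rewrite /nonneg_rank; case: ex_minnP => r /asboolP dr _.
exact: tau_plus_le_nonneg_decomposition.
Qed.
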